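(* For a full Lebesgue measure set of points $x\in[0,1]$, the local level set $L_x^{loc}$ is a Cantor set (closed, totally disconnected, perfect set) having Hausdorff dimension $0$.
   Context: For $x\in[0,1]$ write a binary expansion $x=0.b_1b_2b_3\ldots=\sum_{j\ge1} b_j2^{-j}$ with $b_j\in\{0,1\}$; here $x$ is taken to specify a binary expansion (a dyadic rational in $(0,1)$ has two expansions, treated as distinct elements). Topological and metric statements refer to the set of real numbers represented. Put $D_0(x)=0$ and $D_j(x)=j-2(b_1+\cdots+b_j)$ for $j\ge1$. The balance-set is $Z(x)=\{j\ge 0: D_j(x)=0\}=\{c_0<c_1<c_2<\cdots\}$ with $c_0=0$; if $Z(x)$ is finite with last element $c_n$, set $c_{n+1}=+\infty$. The $k$-th block $B_k(x)$ is the indexed string of digits $(b_j)_{c_k<j\le c_{k+1}}$ (all $j>c_k$ if $c_{k+1}=+\infty$). Two expansions are equivalent, $x\sim x'$, if $Z(x)=Z(x')$ and for each $k$ the block $B_k(x')$ either equals $B_k(x)$ or is obtained from it by flipping every digit ($b_j\mapsto 1-b_j$ for all $j$ in the block). The local level set of $x$ is $L_x^{loc}=\{x': x'\sim x\}$. *)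

(* Defs.v *)
From HB Require Import structures.
From mathcomp Require Import all_boot all_order all_algebra.
From mathcomp Require Import all_classical all_reals all_analysis.

Set Implicit Arguments.
Unset Strict Implicit.
Unset Printing Implicit Defensive.

Import Order.TTheory GRing.Theory Num.Theory.
Import numFieldNormedType.Exports.

Local Open Scope classical_set_scope.
Local Open Scope ring_scope.

(* A formal sequence of binary digits, so that the two expansions of a dyadic
   rational are distinct elements.  The digit b_j, j >= 1, is stored at
   position j.-1. *)
Definition expansion := nat -> bool.

(* Meant for j >= 1 only. *)
Definition digit (b : expansion) (j : nat) : bool := b j.-1.

Definition expansion_val (R : realType) (b : expansion) : R :=
  limn (fun n : nat => \sum_(1 <= j < n.+1) (digit b j)%:R / 2 ^+ j : R).
Arguments expansion_val : clear implicits.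

Definition deficient_digit (b : expansion) (j : nat) : int :=
  j%:Z - 2 * \sum_(1 <= i < j.+1) (digit b i)%:Z.

Definition balance_set (b : expansion) : set nat :=
  [set j | deficient_digit b j = 0].

(* The least element of the balance-set larger than [m]; [None] is +oo. *)
Definition next_balance (b : expansion) (m : nat) : option nat :=
  if pselect (exists n, (m < n)%N && (deficient_digit b n == 0)) is left ex
  then Some (ex_minn ex) else None.

(* c_k, the k-th element of the balance-set.  If the balance-set is finite with
   last element c_n, then c_k is [None] for all k > n. *)
Fixpoint balance_point (b : expansion) (k : nat) : option nat :=
  if k is k'.+1 then obind (next_balance b) (balance_point b k') else Some 0%N.

(* The set of indices j with c_k < j <= c_{k+1} of the digits of the k-th block;
   it is empty when c_k is +oo, i.e. when there is no k-th block. *)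
Definition block_index (b : expansion) (k : nat) : set nat :=
  [set j | if balance_point b k is Some m then
             (m < j)%N /\
             (if balance_point b k.+1 is Some n then (j <= n)%N else True)
           else False].

Definition same_block (b b' : expansion) (k : nat) : Prop :=
  forall j, block_index b k j -> digit b' j = digit b j.

Definition flipped_block (b b' : expansion) (k : nat) : Prop :=
  forall j, block_index b k j -> digit b' j = ~~ digit b j.

(* Comparing digits over [block_index b k] is enough: the balance-sets being
   equal, b and b' have the same block indices. *)
Definition expansion_equiv (b b' : expansion) : Prop :=
  balance_set b = balance_set b' /\
  forall k, same_block b b' k \/ flipped_block b b' k.

(* As a subset of the real line. *)
Definition local_level_set (R : realType) (b : expansion) : set R :=
  [set expansion_val R b' | b' in [set b' | expansion_equiv b b']].
Arguments local_level_set : clear implicits.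

Definition cantor_set (T : topologicalType) (A : set T) : Prop :=
  [/\ A !=set0, closed A, totally_disconnected A & perfect_set A].

Section HausdorffDimension.
Context {R : realType}.
Local Open Scope ereal_scope.

(* -oo for the empty set. *)
Definition diam (A : set R) : \bar R :=
  ereal_sup [set `|p.1 - p.2|%:E | p in A `*` A].

(* diam(A)^s, where the empty set counts for 0 and, at s = 0, every nonempty
   set of finite diameter for 1. *)
Definition diam_pow (s : R) (A : set R) : \bar R :=
  if A == set0 then 0 else poweR (diam A) s.

Definition hausdorff_content (s delta : R) (A : set R) : \bar R :=
  ereal_inf [set \sum_(0 <= i <oo) diam_pow s (U i) |
    U in [set U : nat -> set R | A `<=` \bigcup_i U i /\
                                 forall i, diam (U i) <= delta%:E]].

Definition hausdorff_measure (s : R) (A : set R) : \bar R :=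
  ereal_sup [set hausdorff_content s delta A |
    delta in [set delta : R | (0 < delta)%R]].

Definition hausdorff_dim (A : set R) : \bar R :=
  ereal_inf [set s%:E |
    s in [set s : R | (0 <= s)%R /\ hausdorff_measure s A = 0]].

End HausdorffDimension.

(* Main.v *)
Require Import Defs.
From HB Require Import structures.
From mathcomp Require Import all_boot all_order all_algebra.
From mathcomp Require Import all_classical all_reals all_analysis.
From mathcomp Require Import zify ring lra.

Import Order.TTheory GRing.Theory Num.Theory.
Import numFieldNormedType.Exports.

Local Open Scope classical_set_scope.
Local Open Scope ring_scope.

Set Implicit Arguments.
Unset Strict Implicit.
Unset Printing Implicit Defensive.

(** Read the digits of an expansion as the steps of a walk on the integers, +1
    for the digit 0 and -1 for the digit 1; the deficient digit functions are
    then the positions of this walk, and the balance-set is the set of its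
    zeros.  Under Lebesgue measure the walk is the simple random walk, and two
    almost sure properties of it give the whole theorem.

    - It is recurrent: the balance-set is infinite.  The probability q(h) of
      never reaching 0 from h is harmonic away from 0, hence linear on each
      side of 0; being bounded and zero at 0, it vanishes
      ([bounded_harmonic_eq0], [avoids_zero_from_null]).
    - Its zeros are sparse: for each eps > 0, infinitely many n are such that
      the walk has fewer than eps * n zeros before time n.  Indeed |walk| minus
      the number of past zeros is a martingale, so that the mean number of zeros
      before n is the mean of |walk|, of order the square root of n.  Markov's
      inequality along the squares then excludes a linear number of zeros
      ([prefix_freq_zero_visits], [many_visits_null]).

    Probabilities are handled by counting: a property of expansions is null if,
    for suitable n, the words of length n which start some expansion with this
    property form an arbitrarily small fraction of all words.  Each such word
    puts the value in a closed interval of length 2^-n ([prefix_cover]), so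
    that the set of values of a null property is Lebesgue negligible, whichever
    of its two expansions a dyadic rational is given by
    ([prefix_null_negligible]).

    The rest is deterministic.  An expansion is equivalent to b if and only if
    the digits at which it differs from b are constant along each excursion of
    the walk away from 0 ([expansion_equivP]).  This is a closed condition, and
    the value map is continuous on the Cantor space, so that the local level set
    is compact, whence closed.  Flipping a single far excursion moves a point by
    a small nonzero amount, and recurrence supplies such excursions, so the set
    is perfect ([local_level_set_perfect]).  A prefix of length n of an expansion
    equivalent to b is determined by one binary choice per zero of the walk
    before n, so that the local level set is covered by 2^N intervals of length
    2^-n, N being the number of these zeros ([prefix_count_coherent]).
    Sparseness makes N / n arbitrarily small, so that all Hausdorff measures of
    positive exponent vanish, as does the Lebesgue measure; a Lebesgue null set
    contains no interval, and is therefore totally disconnected. *)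

(** * Values of expansions *)

Definition shift_digits (b : expansion) : expansion := fun i => b i.+1.

Definition cons_digit (d : bool) (b : expansion) : expansion :=
  fun i => if i is j.+1 then b j else d.

Lemma cons_shift_digits b : cons_digit (b 0%N) (shift_digits b) = b.
Proof. by apply/funext => -[|i]. Qed.

Definition partial_val (R : realType) (b : expansion) (n : nat) : R :=
  \sum_(0 <= j < n) (b j)%:R / 2 ^+ j.+1.

Lemma expansion_valE (R : realType) b :
  expansion_val R b = limn (partial_val R b).
Proof. by congr (limn _); apply/funext => n; rewrite big_add1. Qed.

Lemma partial_valS (R : realType) b n :
  partial_val R b n.+1 =
  ((b 0%N)%:R + partial_val R (shift_digits b) n) / 2.
Proof.
rewrite /partial_val big_nat_recl// expr1 mulrDl; congr (_ + _).
rewrite mulr_suml; apply: eq_bigr => i _.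
by rewrite exprS invfM mulrCA mulrC.
Qed.

Lemma partial_val_bounds (R : realType) b n : 0 <= partial_val R b n <= 1.
Proof.
elim: n b => [|n IHn] b; first by rewrite /partial_val big_geq// lexx ler01.
rewrite partial_valS; move: (IHn (shift_digits b)) => /andP[h0 h1].
by case: (b 0%N) => /=; apply/andP; split; lra.
Qed.

Lemma partial_val_cvg (R : realType) b : cvgn (partial_val R b).
Proof.
apply: nondecreasing_is_cvgn.
  apply/nondecreasing_seqP => n; rewrite /partial_val big_nat_recr//= lerDl.
  by rewrite divr_ge0// exprn_ge0.
by exists 1 => _ [n _ <-]; case/andP: (partial_val_bounds R b n).
Qed.

Lemma expansion_val_bounds (R : realType) b : 0 <= expansion_val R b <= 1.
Proof.
rewrite expansion_valE; apply/andP; split.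
  apply: limr_ge; first exact: partial_val_cvg.
  by apply: nearW => n; case/andP: (partial_val_bounds R b n).
apply: limr_le; first exact: partial_val_cvg.
by apply: nearW => n; case/andP: (partial_val_bounds R b n).
Qed.

(** Self-similarity of the value map: every fact on values below is derived from
    this equation and the bounds 0 and 1, by induction on a length. *)
Lemma expansion_val_shift (R : realType) b :
  expansion_val R b =
  ((b 0%N)%:R + expansion_val R (shift_digits b)) / 2.
Proof.
rewrite !expansion_valE; apply/cvg_lim => //; rewrite -cvg_shiftS.
under eq_fun do rewrite partial_valS.
by apply: cvgMl; apply: cvgD; [exact: cvg_cst|exact: partial_val_cvg].
Qed.

Lemma expansion_val_near (R : realType) n (b b' : expansion) :
  (forall i, (i < n)%N -> b' i = b i) ->
  `|expansion_val R b' - expansion_val R b| <= 2 ^- n.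
Proof.
elim: n b b' => [|n IHn] b b' bb'.
  move: (expansion_val_bounds R b) (expansion_val_bounds R b').
  rewrite expr0 invr1 ler_norml => /andP[? ?] /andP[? ?].
  by apply/andP; split; lra.
rewrite (expansion_val_shift R b) (expansion_val_shift R b') (bb' 0%N)//.
rewrite -mulrBl opprD addrACA subrr add0r normrM [`|2^-1|]ger0_norm//.
rewrite exprSr invfM ler_wpM2r//.
by apply: IHn => i ilt; apply: bb'.
Qed.

Lemma expansion_val_eq0 (R : realType) b i :
  expansion_val R b = 0 -> b i = false.
Proof.
elim: i b => [|i IHi] b; rewrite expansion_val_shift;
  case/andP: (expansion_val_bounds R (shift_digits b)) => ? _.
  by case: (b 0%N) => //= ?; exfalso; lra.
move=> b0; apply: (IHi (shift_digits b)).
by move: b0; case: (b 0%N) => /=; lra.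
Qed.

Lemma expansion_val_eq1 (R : realType) b i :
  expansion_val R b = 1 -> b i = true.
Proof.
elim: i b => [|i IHi] b; rewrite expansion_val_shift;
  case/andP: (expansion_val_bounds R (shift_digits b)) => _ ?.
  by case: (b 0%N) => //= ?; exfalso; lra.
move=> b0; apply: (IHi (shift_digits b)).
by move: b0; case: (b 0%N) => /=; lra.
Qed.

(** Two expansions of the same number that differ first at position n are dyadic
    there: one continues with 1s only and the other one with 0s only.  They
    thus cannot agree again at any later position m. *)
Lemma expansion_val_neq (R : realType) n m (b b' : expansion) :
  (n < m)%N -> (forall i, (i < n)%N -> b' i = b i) -> b' n != b n ->
  b' m = b m -> expansion_val R b' != expansion_val R b.
Proof.
move=> nm agree neq eqm; apply/eqP; move: nm agree neq eqm.
elim: n m b b' => [|n IHn] [//|m] b b' nm agree; last first.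
  move=> neq eqm vals; apply: (IHn m (shift_digits b) (shift_digits b')) => //.
    by move=> i ilt; apply: agree.
  move: vals; rewrite (expansion_val_shift R b) (expansion_val_shift R b') agree//.
  lra.
move=> neq eqm vals.
move: neq vals; rewrite (expansion_val_shift R b) (expansion_val_shift R b').
move: (expansion_val_bounds R (shift_digits b))
      (expansion_val_bounds R (shift_digits b')).
move=> /andP[? ?] /andP[? ?].
case: (b 0%N); case: (b' 0%N) => //= _ vals.
- have v0 : expansion_val R (shift_digits b) = 0 by lra.
  have v1 : expansion_val R (shift_digits b') = 1 by lra.
  by move: (expansion_val_eq0 m v0) (expansion_val_eq1 m v1) eqm;
    rewrite /shift_digits => -> ->.
- have v0 : expansion_val R (shift_digits b') = 0 by lra.
  have v1 : expansion_val R (shift_digits b) = 1 by lra.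
  by move: (expansion_val_eq0 m v0) (expansion_val_eq1 m v1) eqm;
    rewrite /shift_digits => -> ->.
Qed.

(** * Counting prefixes and null sets *)

(** The number of words of length n which are a prefix of some element of P.
    Splitting along the first digit matches the recursions of the value map and
    of the walk. *)
Fixpoint prefix_count (n : nat) (P : set expansion) : nat :=
  if n is m.+1 then
    (prefix_count m [set b | P (cons_digit false b)] +
     prefix_count m [set b | P (cons_digit true b)])%N
  else `[< P !=set0 >].

Lemma prefix_count_mono n (P Q : set expansion) :
  P `<=` Q -> (prefix_count n P <= prefix_count n Q)%N.
Proof.
elim: n P Q => [|n IHn] P Q PQ /=; last by apply: leq_add; apply: IHn => b /PQ.
by case: asboolP => // -[b /PQ Qb]; case: asboolP => // -[]; exists b.
Qed.

Lemma prefix_count_set0 n : prefix_count n set0 = 0%N.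
Proof.
elim: n => [|n IHn] /=; first by case: asboolP => // -[].
by rewrite [X in prefix_count n X](_ : _ = set0) ?IHn.
Qed.

Lemma prefix_countS n P : (prefix_count n.+1 P <= 2 * prefix_count n P)%N.
Proof.
elim: n P => [|n IHn] P; last by rewrite [(_ <= _)%N]/= mulnDr leq_add ?IHn.
rewrite /= mul2n -addnn; apply: leq_add;
  by case: asboolP => // -[b Pb]; case: asboolP => // -[]; eexists; exact: Pb.
Qed.

Definition prefix_freq (R : realType) (n : nat) (P : set expansion) : R :=
  (prefix_count n P)%:R / 2 ^+ n.

Lemma prefix_freqS (R : realType) n P :
  prefix_freq R n.+1 P = (prefix_freq R n [set b | P (cons_digit false b)] +
                          prefix_freq R n [set b | P (cons_digit true b)]) / 2.
Proof. by rewrite /prefix_freq /= natrD exprSr invfM mulrA -mulrDl. Qed.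

Lemma prefix_freq_mono (R : realType) n (P Q : set expansion) :
  P `<=` Q -> prefix_freq R n P <= prefix_freq R n Q.
Proof. by move=> PQ; rewrite ler_wpM2r// ler_nat prefix_count_mono. Qed.

Lemma prefix_freq_set0 (R : realType) n : prefix_freq R n set0 = 0.
Proof. by rewrite /prefix_freq prefix_count_set0 mul0r. Qed.

Lemma prefix_freq_ge0 (R : realType) n P : 0 <= prefix_freq R n P.
Proof. by rewrite divr_ge0// exprn_ge0. Qed.

Lemma prefix_freq_nonincr (R : realType) P :
  nonincreasing_seq (fun n => prefix_freq R n P).
Proof.
apply/nonincreasing_seqP => n; rewrite /prefix_freq exprS invfM mulrA.
rewrite ler_wpM2r// ler_pdivrMr// -natrM ler_nat mulnC; exact: prefix_countS.
Qed.

Lemma prefix_freq_le1 (R : realType) n P : prefix_freq R n P <= 1.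
Proof.
apply: (le_trans (prefix_freq_nonincr R P (leq0n n))).
by rewrite /prefix_freq expr0 divr1 lern1 /=; case: asboolP.
Qed.

(** A word of length n confines the value to a dyadic interval of length 2^-n,
    taken closed so that it contains both expansions of its endpoints. *)
Lemma prefix_cover (R : realType) n (P : set expansion) :
  exists2 s : seq R, size s = prefix_count n P &
    forall b, P b -> exists2 a, a \in s &
      expansion_val R b \in `[a, a + 2 ^- n].
Proof.
elim: n P => [|n IHn] P.
  have [[b0 Pb0]|P0] := pselect (P !=set0); last first.
    exists [::]; first by rewrite /=; case: asboolP.
    by move=> b Pb; exfalso; apply: P0; exists b.
  exists [:: 0]; first by rewrite /=; case: asboolP => // -[]; exists b0.
  move=> b _; exists 0; first by rewrite inE.
  by rewrite in_itv/= expr0 invr1 add0r expansion_val_bounds.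
have [s0 sz0 cov0] := IHn [set b | P (cons_digit false b)].
have [s1 sz1 cov1] := IHn [set b | P (cons_digit true b)].
exists ([seq a / 2 | a <- s0] ++ [seq (1 + a) / 2 | a <- s1]).
  by rewrite size_cat !size_map sz0 sz1.
move=> b; rewrite -(cons_shift_digits b) expansion_val_shift exprSr invfM.
case: (b 0%N) => /= Pb.
  have [a as1] := cov1 _ Pb; rewrite in_itv/= => /andP[? ?].
  exists ((1 + a) / 2).
    by rewrite mem_cat orbC (map_f (fun a => (1 + a) / 2)).
  by rewrite in_itv/=; apply/andP; split; lra.
have [a as0] := cov0 _ Pb; rewrite in_itv/= => /andP[? ?].
exists (a / 2); first by rewrite mem_cat (map_f (fun a => a / 2)).
by rewrite in_itv/=; apply/andP; split; lra.
Qed.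

(** The frequencies decrease to the coin-tossing measure of the closure of P,
    so this says that the closure of P is null.  It suffices for the closed events
    considered here and avoids a measure on the space of expansions. *)
Definition prefix_null (R : realType) (P : set expansion) : Prop :=
  forall e : R, 0 < e -> exists n, prefix_freq R n P <= e.

Lemma measurable_cover_itv (R : realType) (s : seq R) (l : R) : 0 <= l ->
  exists C : set R, [/\ measurable C,
    (lebesgue_measure C <= ((size s)%:R * l)%:E)%E &
    forall a, a \in s -> [set` `[a, a + l]] `<=` C].
Proof.
move=> l0; elim: s => [|a s [C [mC Cle sC]]].
  by exists set0; split; rewrite ?measure0 ?mul0r.
have ma : measurable [set` `[a, a + l]] by exact: measurable_itv.
exists ([set` `[a, a + l]] `|` C); split; first exact: measurableU.
  apply: (le_trans (measureU2 _ _ _)) => //.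
  rewrite /= -natr1 mulrDl mul1r addrC EFinD leeD//.
  rewrite lebesgue_measure_itv/= lte_fin.
  by case: ifP => _; rewrite -?EFinB ?lee_fin// addrAC subrr add0r.
move=> a'; rewrite inE => /predU1P[->|/sC aC]; first exact: subsetUl.
by apply: (subset_trans aC); exact: subsetUr.
Qed.

(** The covers of [prefix_cover] have total length the frequency of the prefixes,
    which is arbitrarily small; their intersection is a null Borel set. *)
Lemma prefix_null_negligible (R : realType) (P : set expansion) :
  prefix_null R P ->
  (@lebesgue_measure R).-negligible [set expansion_val R b | b in P].
Proof.
move=> nullP.
have /choice[C CP] : forall k : nat, exists C : set R, [/\ measurable C,
    (lebesgue_measure C <= (k.+1%:R^-1)%:E)%E &
    [set expansion_val R b | b in P] `<=` C].
  move=> k; have [n nk] := nullP k.+1%:R^-1 ltac:(by rewrite invr_gt0 ltr0n).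
  have [s sz cov] := prefix_cover R n P.
  have l0 : 0 <= 2 ^- n :> R by rewrite invr_ge0 exprn_ge0.
  have [C [mC Cle sC]] := measurable_cover_itv s l0.
  exists C; split=> //; first by rewrite (le_trans Cle)// lee_fin sz.
  by move=> _ [b /cov [a /sC aC xa] <-]; exact: aC.
exists (\bigcap_k C k); split.
- by apply: bigcap_measurableType => k _; case: (CP k).
- apply/eqP; rewrite eq_le measure_ge0 andbT; apply/lee_addgt0Pr => e e0.
  have [k ke] : exists k : nat, k.+1%:R^-1 <= e.
    have [k _ /(_ k)] := near_infty_natSinv_lt (PosNum e0).
    by move=> /(_ (leqnn k)) /ltW; exists k.
  case: (CP k) => mC Cle _; rewrite add0e.
  apply: (@le_trans _ _ (lebesgue_measure (C k))); last first.
    by rewrite (le_trans Cle)// lee_fin.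
  apply: le_measure; rewrite ?inE//; last exact: bigcap_inf.
  by apply: bigcap_measurableType => j _; case: (CP j).
- by move=> x Px k _; case: (CP k) => _ _; apply.
Qed.

(** * Recurrence of the digit walk *)

(** The increment of j - 2 (b_1 + ... + b_j). *)
Definition step (d : bool) : int := if d then -1 else 1.

(** The starting point h varies so that deleting the first digit of an expansion
    yields a walk of the same kind; this is what the inductions rely on. *)
Fixpoint walk (h : int) (b : expansion) (n : nat) : int :=
  if n is m.+1 then walk (h + step (b 0%N)) (shift_digits b) m else h.

Lemma walkSr h b n : walk h b n.+1 = walk h b n + step (b n).
Proof. by elim: n h b => [|n IHn] h b //; rewrite [LHS]IHn. Qed.

Lemma deficient_digitE b n : deficient_digit b n = walk 0 b n.
Proof.
elim: n => [|n IHn]; first by rewrite /deficient_digit big_geq.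
rewrite walkSr -IHn /deficient_digit big_nat_recr//=.
rewrite /digit/= /step; set s := \sum_(_ <= _ < _) _.
by case: (b n) => /=; lia.
Qed.

Definition avoids_zero_from (m : nat) (h : int) : set expansion :=
  [set b | forall j, (m <= j)%N -> walk h b j != 0].

(** The Markov property of the walk at its first step. *)
Lemma avoids_zero_cons (h : int) d : h != 0 ->
  [set b | avoids_zero_from 0 h (cons_digit d b)] =
  avoids_zero_from 0 (h + step d).
Proof.
move=> h0; apply/seteqP; split=> b /= Ab j _; first exact: (Ab j.+1).
by case: j => [//|j]; exact: Ab.
Qed.

(** A function harmonic on the positive integers and zero at 0 is k |-> k * q 1,
    which is bounded only if q 1 = 0. *)
Lemma bounded_harmonic_eq0 (R : realType) (q : nat -> R) :
  (forall k, 0 <= q k <= 1) -> q 0%N = 0 ->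
  (forall k, q k.+1 = (q k.+2 + q k) / 2) -> forall k, q k = 0.
Proof.
move=> qb q0 qh.
have lin k : q k = k%:R * q 1%N /\ q k.+1 = k.+1%:R * q 1%N.
  elim: k => [|k [IHk IHk1]]; first by rewrite q0 mul0r mul1r.
  split=> //; have := qh k; rewrite IHk IHk1 -(natr1 k.+1) -(natr1 k).
  by move: (k%:R : R) (q 1%N) (q k.+2) => x y z; lra.
have q1 : q 1%N = 0.
  apply/eqP; rewrite eq_le (andP (qb 1%N)).1 andbT leNgt; apply/negP => q1.
  have [k _ /(_ k (leqnn k))] := near_infty_natSinv_lt (PosNum q1).
  rewrite /= invf_plt ?posrE ?ltr0n// => kq.
  move: (qb k.+1) => /andP[_]; rewrite (lin k).2 leNgt => /negP; apply.
  by rewrite -ltr_pdivrMr// div1r.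
by move=> k; rewrite (lin k).1 q1 mulr0.
Qed.

(** The limit frequency q(h) of the walks that never reach 0 from h is harmonic off
    0 by the Markov property, and [bounded_harmonic_eq0] applies on each side. *)
Lemma avoids_zero_null (R : realType) (h : int) :
  prefix_null R (avoids_zero_from 0 h).
Proof.
pose q (h : int) : R := limn (fun n => prefix_freq R n (avoids_zero_from 0 h)).
have qcvg h' : (fun n => prefix_freq R n (avoids_zero_from 0 h')) @ \oo --> q h'.
  apply: nonincreasing_is_cvgn; first exact: prefix_freq_nonincr.
  by exists 0 => _ [n _ <-]; exact: prefix_freq_ge0.
have qb h' : 0 <= q h' <= 1.
  apply/andP; split.
    apply: limr_ge; first by apply/cvg_ex; exists (q h').
    by apply: nearW => n; exact: prefix_freq_ge0.
  apply: limr_le; first by apply/cvg_ex; exists (q h').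
  by apply: nearW => n; exact: prefix_freq_le1.
have q0 : q 0 = 0.
  apply/cvg_lim => //; have -> : avoids_zero_from 0 0 = set0.
    by apply/seteqP; split=> // b /(_ 0%N (leqnn 0)).
  by under eq_fun do rewrite prefix_freq_set0; exact: cvg_cst.
have qh h' : h' != 0 -> q h' = (q (h' + 1) + q (h' - 1)) / 2.
  move=> h0; apply/cvg_lim => //; rewrite -cvg_shiftS.
  under eq_fun do rewrite prefix_freqS !avoids_zero_cons//=.
  by apply: cvgMl; apply: cvgD; exact: qcvg.
have qpos k : q k%:Z = 0.
  apply: (@bounded_harmonic_eq0 _ (fun k => q k%:Z)) => // {}k.
  rewrite qh//; congr ((q _ + q _) / 2); lia.
have qneg k : q (- k%:Z) = 0.
  apply: (@bounded_harmonic_eq0 _ (fun k => q (- k%:Z))) => // {}k.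
  rewrite qh// addrC; congr ((q _ + q _) / 2); lia.
move=> e e0; have := qcvg h.
have -> : q h = 0.
  by case: (intP h) => [|k|k]; [exact: q0|exact: qpos|exact: qneg].
move=> /cvgrPdist_lt /(_ e e0) [n _ /(_ n (leqnn n))].
by rewrite sub0r normrN => /ltW nh; exists n; exact: le_trans (ler_norm _) nh.
Qed.

Lemma prefix_null_cons (R : realType) (P : set expansion) :
  prefix_null R [set b | P (cons_digit false b)] ->
  prefix_null R [set b | P (cons_digit true b)] -> prefix_null R P.
Proof.
move=> P0 P1 e e0; have [n0 h0] := P0 e e0; have [n1 h1] := P1 e e0.
exists (maxn n0 n1).+1; rewrite prefix_freqS.
have /le_trans/(_ h0) := prefix_freq_nonincr R [set b | P (cons_digit false b)]
  (leq_maxl n0 n1).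
have /le_trans/(_ h1) := prefix_freq_nonincr R [set b | P (cons_digit true b)]
  (leq_maxr n0 n1).
lra.
Qed.

Lemma prefix_null_mono (R : realType) (P Q : set expansion) :
  P `<=` Q -> prefix_null R Q -> prefix_null R P.
Proof.
move=> PQ nQ e /nQ[n hn]; exists n.
exact: le_trans (prefix_freq_mono R n PQ) hn.
Qed.

Lemma avoids_zero_from_null (R : realType) m (h : int) :
  prefix_null R (avoids_zero_from m h).
Proof.
elim: m h => [|m IHm] h; first exact: avoids_zero_null.
apply: prefix_null_cons; [move: (IHm (h + 1))|move: (IHm (h - 1))];
  apply: prefix_null_mono => b /= Ab j mj; exact: (Ab j.+1).
Qed.

(** * Zeros of the digit walk have density zero along a subsequence *)

Definition zero_visits (h : int) (b : expansion) (n : nat) : nat :=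
  \sum_(0 <= j < n) (walk h b j == 0).

Lemma zero_visitsS h b n : zero_visits h b n.+1 =
  ((h == 0) + zero_visits (h + step (b 0%N)) (shift_digits b) n)%N.
Proof. by rewrite /zero_visits big_nat_recl. Qed.

(** An upper bound for the mean number of zeros before time n from h.  By Tanaka's
    formula, this mean is the mean of |walk n| minus |h|; and |x| is at most
    (x^2 / c + c) / 2, where x^2 has mean n + h^2 at time n. *)
Definition visit_potential (R : realType) (c : R) (n : nat) (h : int) : R :=
  ((n%:R + h%:~R ^+ 2) / c + c) / 2 - `|h|%:~R.

Lemma visit_potential_ge0 (R : realType) (c : R) n h : 0 < c ->
  0 <= visit_potential c n h.
Proof.
move=> c0; have -> : visit_potential c n h =
    (n%:R + (`|h|%:~R - c) ^+ 2) / c / 2.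
  rewrite /visit_potential -(real_normK (num_real h%:~R)) -intr_norm.
  by field; rewrite gt_eqF.
by rewrite divr_ge0// divr_ge0 ?(ltW c0)// addr_ge0 ?sqr_ge0.
Qed.

(** The discrete Tanaka formula: the mean of |h + 1| and |h - 1| is |h|, plus 1
    exactly when h = 0.  The quadratic part compensates the lost unit of time. *)
Lemma visit_potential_step (R : realType) (c : R) n h : 0 < c ->
  (visit_potential c n (h + 1) + visit_potential c n (h - 1)) / 2 + (h == 0)%:R
  = visit_potential c n.+1 h.
Proof.
move=> c0; have : `|h + 1| + `|h - 1| = 2 * `|h| + 2 * (h == 0)%:Z.
  by case: eqP => [->//|]; lia.
move=> /(congr1 (fun z : int => z%:~R : R)).
rewrite !rmorphD !rmorphM /= => habs.
have -> : (h == 0)%:R = (`|h + 1|%:~R + `|h - 1|%:~R) / 2 - `|h|%:~R :> R.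
  by rewrite habs; case: (h == 0) => /=; field.
rewrite /visit_potential -natr1 !rmorphD rmorphN /=.
by field; rewrite gt_eqF.
Qed.

(** Markov's inequality for the number of visits, proved by induction on the time.
    The number a of visits already made is carried along, because a first step
    from 0 increases the count. *)
Lemma prefix_freq_zero_visits (R : realType) (c t : R) n (h : int) (a : R) :
  0 < c -> 0 < t -> 0 <= a ->
  prefix_freq R n [set b | t <= a + (zero_visits h b n)%:R] <=
  (a + visit_potential c n h) / t.
Proof.
move=> c0 t0; elim: n h a => [|n IHn] h a a0.
  rewrite /prefix_freq expr0 divr1 /=; case: asboolP => [[b]|_] /=; last first.
    by rewrite divr_ge0 ?(ltW t0)// addr_ge0// visit_potential_ge0.
  rewrite /zero_visits big_geq// addr0 => ta.
  by rewrite ler_pdivlMr// mul1r (le_trans ta)// lerDl visit_potential_ge0.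
have aS d : prefix_freq R n [set b | t <= a +
      (zero_visits h (cons_digit d b) n.+1)%:R] <=
    (a + (h == 0)%:R + visit_potential c n (h + step d)) / t.
  (* The first time step contributes a visit exactly when h = 0, and it is
     moved into the count a of visits already made. *)
  have -> : [set b | t <= a + (zero_visits h (cons_digit d b) n.+1)%:R] =
      [set b | t <= a + (h == 0)%:R + (zero_visits (h + step d) b n)%:R].
    by apply/seteqP; split=> b /=; rewrite zero_visitsS natrD addrA.
  by apply: IHn; rewrite addr_ge0.
rewrite prefix_freqS -visit_potential_step//.
have := aS false; have := aS true => /=.
set x := prefix_freq _ _ _; set y := prefix_freq _ _ _ => xle yle.
apply: (@le_trans _ _ (((a + (h == 0)%:R + visit_potential c n (h + 1)) / t +
   (a + (h == 0)%:R + visit_potential c n (h - 1)) / t) / 2)); first by lra.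
by rewrite le_eqVlt; apply/orP; left; apply/eqP; field; rewrite gt_eqF.
Qed.

(** At time n = c^2 the potential at 0 equals c, the square root of n: the
    frequency of words with at least eps * n zeros is at most 1 / (eps * c). *)
Lemma many_visits_null (R : realType) (eps : R) (m : nat) : 0 < eps ->
  prefix_null R [set b | forall n, (m <= n)%N ->
    eps * n%:R <= (zero_visits 0 b n)%:R].
Proof.
move=> eps0 e e0.
have [k _ /(_ (k + m)%N (leq_addr _ _))] :=
  near_infty_natSinv_lt (PosNum (mulr_gt0 e0 eps0)).
rewrite /=; set c := (k + m).+1 => /ltW ce.
have c0 : 0 < c%:R :> R by rewrite ltr0n.
exists (c ^ 2)%N.
have t0 : 0 < eps * (c ^ 2)%:R by rewrite mulr_gt0// ltr0n expn_gt0.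
apply: (@le_trans _ _ (prefix_freq R (c ^ 2) [set b | eps * (c ^ 2)%:R <=
    0 + (zero_visits 0 b (c ^ 2))%:R])).
  apply: prefix_freq_mono => b /= /(_ (c ^ 2)%N); rewrite add0r; apply.
  by rewrite /c; lia.
apply: (le_trans (prefix_freq_zero_visits _ _ c0 t0 (lexx 0))).
rewrite /visit_potential normr0 subr0 add0r expr0n addr0 natrX.
rewrite (_ : _ / _ = c%:R^-1 / eps); last by field; rewrite !gt_eqF.
by rewrite ler_pdivrMr.
Qed.

(** * Equivalence of expansions as coherent flipping *)

(** The expansions obtained from b by flipping whole excursions of its walk: the
    flipping pattern b' (+) b may change only at a zero of the walk.  The walk of b
    starts at h, and e is the pattern just before the first digit, which goes on
    when h is nonzero, that is, inside an excursion. *)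
Definition coherent_flips (h : int) (e : bool) (b : expansion) : set expansion :=
  [set b' | forall i, walk h b i != 0 ->
    b' i (+) b i = if i is j.+1 then b' j (+) b j else e].

Lemma coherent_flips_cons h e b d b' :
  coherent_flips h e b (cons_digit d b') ->
  coherent_flips (h + step (b 0%N)) (d (+) b 0%N) (shift_digits b) b'.
Proof. by move=> hb i /(hb i.+1) /=; case: i. Qed.

(** A digit of b' is free when the walk of b is at 0, and is forced otherwise. *)
Lemma prefix_count_coherent n h e b :
  (prefix_count n (coherent_flips h e b) <= 2 ^ zero_visits h b n)%N.
Proof.
elim: n h e b => [|n IHn] h e b.
  by rewrite /zero_visits big_geq//= leq_b1.
have cnt d : (prefix_count n [set b' | coherent_flips h e b (cons_digit d b')]
    <= 2 ^ zero_visits (h + step (b 0%N)) (shift_digits b) n)%N.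
  apply: leq_trans (IHn _ (d (+) b 0%N) _); apply: prefix_count_mono => b'.
  exact: coherent_flips_cons.
rewrite /= zero_visitsS expnD.
case: eqVneq => [_|h0]; first by rewrite mul2n -addnn leq_add.
have forced d : d (+) b 0%N != e ->
    prefix_count n [set b' | coherent_flips h e b (cons_digit d b')] = 0%N.
  move=> de; rewrite [X in prefix_count n X](_ : _ = set0) ?prefix_count_set0//.
  apply/seteqP; split=> // b' /= /(_ 0%N h0) /= eqe.
  by rewrite eqe eqxx in de.
rewrite expn0 mul1n; have [e0|e0] := eqVneq (false (+) b 0%N) e.
  rewrite (forced true) ?addn0 ?cnt//.
  by rewrite -e0; case: (b 0%N).
by rewrite (forced false) ?add0n ?cnt.
Qed.

(** Flipping an excursion reflects it in 0; hence the zeros are kept, which gives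
    [balance_set_coherent]. *)
Lemma walk_coherent b b' n : coherent_flips 0 false b b' ->
  walk 0 b' n.+1 = if b' n (+) b n then - walk 0 b n.+1 else walk 0 b n.+1.
Proof.
move=> bb'; elim: n => [|n IHn].
  by rewrite /=; case: (b 0%N); case: (b' 0%N).
rewrite walkSr IHn [in RHS]walkSr.
have [->|/bb' <-] := eqVneq (walk 0 b n.+1) 0.
  by case: (_ (+) b n); rewrite ?oppr0 !add0r /step;
     case: (b n.+1); case: (b' n.+1).
by rewrite /step; case: (b n.+1); case: (b' n.+1) => //=; rewrite opprD ?opprK.
Qed.

Lemma balance_setE b : balance_set b = [set j | walk 0 b j = 0].
Proof. by apply/seteqP; split=> j; rewrite /balance_set/= deficient_digitE. Qed.

Lemma balance_set_coherent b b' : coherent_flips 0 false b b' ->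
  balance_set b = balance_set b'.
Proof.
move=> bb'; rewrite !balance_setE.
have zero j : (walk 0 b j = 0) <-> (walk 0 b' j = 0).
  case: j => [//|j]; rewrite (walk_coherent j bb'); case: (_ (+) _) => //.
  by split=> [->|/eqP]; [rewrite oppr0|rewrite oppr_eq0 => /eqP].
by apply/seteqP; split=> j /zero.
Qed.

Lemma next_balance_SomeP b m n : next_balance b m = Some n ->
  [/\ (m < n)%N, walk 0 b n = 0 & forall j, (m < j < n)%N -> walk 0 b j != 0].
Proof.
rewrite /next_balance; case: pselect => // ex [<-].
case: ex_minnP => {}n /andP[mn]; rewrite deficient_digitE => /eqP n0 nmin.
split=> // j /andP[mj jn]; apply: contraL jn => j0.
by rewrite -leqNgt nmin// mj deficient_digitE.
Qed.

Lemma next_balance_NoneP b m : next_balance b m = None ->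
  forall j, (m < j)%N -> walk 0 b j != 0.
Proof.
rewrite /next_balance; case: pselect => // nex _ j mj.
by apply/negP => j0; apply: nex; exists j; rewrite mj deficient_digitE.
Qed.

Lemma next_balance_zero b m n : (m < n)%N -> walk 0 b n = 0 ->
  (forall j, (m < j < n)%N -> walk 0 b j != 0) -> next_balance b m = Some n.
Proof.
move=> mn n0 between; case E: (next_balance b m) => [n'|]; last first.
  by move: (next_balance_NoneP E mn); rewrite n0 eqxx.
have [mn' n'0 between'] := next_balance_SomeP E.
have [nn'|n'n|->//] := ltngtP n n'.
  by move: (between' n); rewrite mn nn' n0 eqxx => /(_ isT).
by move: (between n'); rewrite mn' n'n n'0 eqxx => /(_ isT).
Qed.

(** The walk vanishes only at the last index of a block. *)
Lemma block_index_interior b k j :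
  block_index b k j -> block_index b k j.+1 -> walk 0 b j != 0.
Proof.
rewrite /block_index/=; case: (balance_point b k) => //= m [mj _] [_].
case E: (next_balance b m) => [n|] jn; last exact: next_balance_NoneP E _ mj.
by have [_ _ between] := next_balance_SomeP E; apply: between; rewrite mj.
Qed.

Lemma block_index_exists b j : walk 0 b j.+1 != 0 ->
  exists k, block_index b k j.+1 /\ block_index b k j.+2.
Proof.
have [k [m [bk mj nz]]] : exists k m, [/\ balance_point b k = Some m,
    (m <= j.+1)%N & forall i, (m < i <= j.+1)%N -> walk 0 b i != 0].
  elim: j.+1 => [|i [k [m [bk mi nz]]]].
    exists 0%N, 0%N; split=> // i; by case: i.
  have [i0|i0] := eqVneq (walk 0 b i.+1) 0.
    have nb : next_balance b m = Some i.+1.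
      by apply: next_balance_zero => // l /andP[ml li]; apply: nz; rewrite ml.
    by exists k.+1, i.+1; split=> //= [|l]; [rewrite bk|lia].
  exists k, m; split=> // [|l /andP[ml]]; first exact: leqW.
  by rewrite leq_eqVlt => /predU1P[->//|li]; apply: nz; rewrite ml.
have m0 : walk 0 b m = 0.
  case: k bk => [[<-]//|k] /=; case: (balance_point b k) => //= m'.
  by case/next_balance_SomeP.
move=> j0; have mltj : (m < j.+1)%N.
  by rewrite ltn_neqAle mj andbT; apply: contraNneq j0 => <-; rewrite m0.
exists k; rewrite /block_index/= bk/=.
case E: (next_balance b m) => [n|]; last by split; split=> //; exact: ltnW.
have [mn n0 _] := next_balance_SomeP E.
have jn : (j.+1 < n)%N.
  rewrite ltnNge; apply/negP => nj.
  by move: (nz n); rewrite mn nj n0 eqxx => /(_ isT).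
by split; split=> //; exact: ltnW.
Qed.

(** The flipping pattern cannot change within a block: of two consecutive indices
    of a block, the first one is not a zero of the walk. *)
Lemma coherent_block b b' k : coherent_flips 0 false b b' ->
  same_block b b' k \/ flipped_block b b' k.
Proof.
move=> bb'; rewrite /same_block /flipped_block.
case bk : (balance_point b k) => [m|]; last first.
  by left=> j; rewrite /block_index/= bk.
have const i : block_index b k (m + i).+1 ->
    b' (m + i)%N (+) b (m + i)%N = b' m (+) b m.
  elim: i => [|i IHi]; first by rewrite addn0.
  rewrite addnS => Bi1; have Bi : block_index b k (m + i).+1.
    move: Bi1; rewrite /block_index/= bk/= => -[_ h]; split; first by lia.
    by case: (next_balance b m) h => // n; exact: ltnW.
  by rewrite (bb' (m + i).+1) ?IHi// (block_index_interior Bi Bi1).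
have blk j : block_index b k j -> b' j.-1 (+) b j.-1 = b' m (+) b m.
  move=> Bj; have mj : (m < j)%N by move: Bj; rewrite /block_index/= bk => -[].
  rewrite -(subnKC mj) addSn /=; apply: const; by rewrite -addSn subnKC.
case e : (b' m (+) b m); [right|left] => j /blk; rewrite e /digit;
  by case: (b' _); case: (b _).
Qed.

(** The blocks are the excursions of the walk; equality of the balance-sets is
    automatic, because an excursion and its reflection in 0 have the same zeros. *)
Lemma expansion_equivP b b' :
  expansion_equiv b b' <-> coherent_flips 0 false b b'.
Proof.
split=> [[_ blocks] [|i] //= i0|bb']; last first.
  by split=> [|k]; [exact: balance_set_coherent|exact: coherent_block].
have [k [Bi Bi1]] := block_index_exists i0.
case: (blocks k) => blk; move: (blk _ Bi) (blk _ Bi1); rewrite /digit/= => -> ->.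
  by rewrite !addbb.
by case: (b i); case: (b i.+1).
Qed.

(** * Topology of local level sets and the choice of a scale *)

Lemma exists_expr_half_le (R : realType) (e : R) : 0 < e ->
  exists n0, forall n, (n0 <= n)%N -> 2 ^- n <= e.
Proof.
move=> e0; have [n0 _ h] := near_infty_natSinv_expn_lt (PosNum e0).
by exists n0 => n /h /ltW /=; rewrite div1r.
Qed.

Lemma nbhs_prefix (b : cantor_space) n :
  nbhs b [set b' : cantor_space | forall i, (i < n)%N -> b' i = b i].
Proof.
elim: n => [|n IHn]; first by apply: filterS filterT.
have bn : nbhs b [set b' : cantor_space | b' n = b n].
  exact: (@proj_continuous nat (fun=> bool) n b _ (discrete_set1 (b n))).
apply: filterS (filterI IHn bn) => b' [/= IH eqn] i.
by rewrite ltnS leq_eqVlt => /predU1P[->|/IH].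
Qed.

(** For the product topology on expansions. *)
Lemma expansion_val_continuous (R : realType) :
  continuous (expansion_val R : cantor_space -> R).
Proof.
move=> b; apply/cvgrPdist_le => e /exists_expr_half_le[n nle].
apply: filterS (nbhs_prefix b n) => b' agree.
rewrite distrC; apply: le_trans (nle n (leqnn n)).
exact: expansion_val_near.
Qed.

Lemma coherent_flips_closed h e b :
  closed (coherent_flips h e b : set cantor_space).
Proof.
move=> b' cl i wi.
have [b'' [hb'' agree]] := cl _ (nbhs_prefix b' i.+1).
rewrite -(agree i)//; move: (hb'' i wi); case: i {wi} agree => [//|i] agree.
by rewrite (agree i).
Qed.

Lemma local_level_setE (R : realType) b : local_level_set R b =
  [set expansion_val R b' | b' in coherent_flips 0 false b].
Proof.
apply/seteqP; split=> _ [b' bb' <-]; exists b' => //; exact/expansion_equivP.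
Qed.

(** The continuous image of a closed subset of the compact Cantor space. *)
Lemma local_level_set_closed (R : realType) b : closed (local_level_set R b).
Proof.
rewrite local_level_setE; apply: compact_closed; first exact: Rhausdorff.
apply: (@continuous_compact cantor_space R (expansion_val R)).
  by apply: continuous_subspaceT; exact: expansion_val_continuous.
by apply: subclosed_compact cantor_space_compact _ => //;
  exact: coherent_flips_closed.
Qed.

Definition flip_between (n m : nat) (b : expansion) : expansion :=
  fun i => b i (+) (n <= i < m)%N.

(** The pattern changes only at n and m, which are zeros of the walk. *)
Lemma coherent_flip_between b b' n m :
  walk 0 b n = 0 -> walk 0 b m = 0 ->
  coherent_flips 0 false b b' -> coherent_flips 0 false b (flip_between n m b').
Proof.
move=> bn bm bb' [//|i] wi; rewrite /flip_between addbAC (bb' _ wi) addbAC.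
have [ni mi] : n != i.+1 /\ m != i.+1.
  by split; apply: contraNneq wi => <-; apply/eqP.
by congr (_ (+) _); lia.
Qed.

Definition recurrent (b : expansion) : Prop :=
  forall m, exists2 n, (m <= n)%N & walk 0 b n = 0.

(** Flip the digits between two zeros n < m of the walk, with n large.  Since
    the digits before n and after m are unchanged, the new value is close to the
    old one, and distinct from it by [expansion_val_neq]. *)
Lemma local_level_set_perfect (R : realType) b :
  recurrent b -> perfect_set (local_level_set R b).
Proof.
move=> rec; split; first exact: local_level_set_closed.
apply/seteqP; split=> x.
  move=> lx; apply: local_level_set_closed; exact: subset_limit_point lx.
rewrite local_level_setE => -[b' bb' <-{x}] U /nbhs_ballP[e e0 eU].
have [n0 n0e] := exists_expr_half_le (divr_gt0 e0 (ltr0n R 2)).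
have [n n0n bn] := rec n0; have [m nm bm] := rec n.+1.
have agree i : (i < n)%N -> flip_between n m b' i = b' i.
  by move=> ilt; rewrite /flip_between leqNgt ilt addbF.
exists (expansion_val R (flip_between n m b')); split.
- apply: (expansion_val_neq R nm agree); rewrite /flip_between.
    by rewrite leqnn nm /=; case: (b' n).
  by rewrite ltnn andbF addbF.
- by exists (flip_between n m b') => //; exact: coherent_flip_between.
- apply: eU; rewrite /ball/= distrC.
  apply: le_lt_trans (expansion_val_near R agree) _.
  by apply: le_lt_trans (n0e n n0n) _; rewrite gtr_pMr ?invf_lt1 ?ltr1n.
Qed.

Definition sparse_zeros (R : realType) (b : expansion) : Prop :=
  forall eps : R, 0 < eps -> forall m, exists2 n, (m <= n)%N &
    (zero_visits 0 b n)%:R < eps * n%:R.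

Lemma powR2_le (R : realType) (x y : R) : x <= y -> 2 `^ x <= 2 `^ y.
Proof. by move=> xy; rewrite ler_powR// ler1n. Qed.

(** With N zeros before n and N < (s / 2) * n, the sum 2^N * (2^-n)^s is at most
    2^-(n * s / 2); it is small if n is large. *)
Lemma exists_sparse_scale (R : realType) (b : expansion) (s delta e : R) :
  sparse_zeros R b -> 0 < s -> 0 < delta -> 0 < e ->
  exists n, [/\ 2 ^- n <= delta :> R &
    2 ^+ zero_visits 0 b n * (2 ^- n) `^ s <= e].
Proof.
move=> sp s0 d0 e0.
have s20 : 0 < s / 2 by rewrite divr_gt0.
have [n0 n0d] := exists_expr_half_le d0.
have [n1 n1e] := exists_expr_half_le e0.
have [k _ /(_ k (leqnn k)) /=] := near_infty_natSinv_lt (PosNum s20).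
rewrite invf_plt ?posrE ?ltr0n// => ks.
(* As 1 / (k + 1) < s / 2, any n >= n1 * (k + 1) has n1 <= n * s / 2. *)
have [n nlarge nsparse] := sp _ s20 (maxn n0 (n1 * k.+1)).
exists n; split; first by apply: n0d; rewrite (leq_trans _ nlarge)// leq_maxl.
apply: le_trans (n1e n1 (leqnn _)).
rewrite -!powR_mulrn// -!powRN -powRrM -powRD ?pnatr_eq0 ?implybT//.
apply: powR2_le.
have n1n : n1%:R <= s / 2 * n%:R.
  have : (n1 * k.+1)%:R <= n%:R :> R.
    by rewrite ler_nat (leq_trans _ nlarge)// leq_maxr.
  rewrite natrM -ler_pdivlMr ?ltr0n// => /le_trans; apply.
  rewrite mulrC ler_wpM2r//; apply: ltW.
  by rewrite invf_plt ?posrE ?ltr0n.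
by move: nsparse n1n; lra.
Qed.

(** * Disconnectedness, Hausdorff dimension and the almost everywhere statement *)

(** A component with two points contains an interval of positive length. *)
Lemma negligible_totally_disconnected (R : realType) (A : set R) :
  (@lebesgue_measure R).-negligible A -> totally_disconnected A.
Proof.
move=> nA x Ax; apply/seteqP; split=> [y|_ ->]; last first.
  exact: connected_component_refl.
have /connected_intervalP itvC : connected (connected_component A x).
  exact: component_connected.
move=> Cy; apply/eqP; apply: contraT => neq.
have Cx := connected_component_refl Ax.
have sub u v : connected_component A x u -> connected_component A x v ->
    u < v -> False.
  move=> Cu Cv uv; have : (@lebesgue_measure R).-negligible [set` `[u, v]].
    apply: negligibleS nA => z /=; rewrite in_itv/= => uzv.
    by apply: (@connected_component_sub _ A x); exact: itvC uzv.
  move=> /measure_negligible; rewrite /= lebesgue_measure_itv/= lte_fin uv.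
  move=> /(_ (measurable_itv _)) /eqP.
  by rewrite -EFinB eqe subr_eq0 gt_eqF.
by move: neq; rewrite neq_lt => /orP[yx|xy]; exfalso;
  [exact: sub yx|exact: sub xy].
Qed.

(** The case s = 1 of [exists_sparse_scale] says that the local level set has
    Lebesgue measure zero. *)
Lemma local_level_set_totally_disconnected (R : realType) b :
  sparse_zeros R b -> totally_disconnected (local_level_set R b).
Proof.
move=> sp; apply: negligible_totally_disconnected.
rewrite local_level_setE; apply: prefix_null_negligible => e e0.
have [n [_ ne]] := exists_sparse_scale sp ltr01 ltr01 e0.
exists n; apply: le_trans ne; rewrite powRr1 ?invr_ge0 ?exprn_ge0//.
by rewrite ler_wpM2r ?invr_ge0 ?exprn_ge0// -natrX ler_nat prefix_count_coherent.
Qed.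

Local Open Scope ereal_scope.

Lemma diam_itv_le (R : realType) (a l : R) : diam [set` `[a, a + l]%R] <= l%:E.
Proof.
apply: ge_ereal_sup => _ [[x y] [/= + +] <-]; rewrite !in_itv/= lee_fin.
by move=> /andP[? ?] /andP[? ?]; rewrite ler_norml; apply/andP; split; lra.
Qed.

Lemma diam_ge0 (R : realType) (A : set R) : A !=set0 -> 0 <= diam A.
Proof.
move=> [a Aa]; apply: ereal_sup_ubound; exists (a, a) => //=.
by rewrite subrr normr0.
Qed.

Lemma diam_pow_ge0 (R : realType) (s : R) (A : set R) : 0 <= diam_pow s A.
Proof. by rewrite /diam_pow; case: ifP => // _; exact: poweR_ge0. Qed.

Lemma diam_pow_le (R : realType) (s l : R) (A : set R) : (0 <= s)%R ->
  diam A <= l%:E -> diam_pow s A <= (l `^ s)%:E.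
Proof.
move=> s0 Al; rewrite /diam_pow; case: ifPn => [_|/set0P A0].
  by rewrite lee_fin powR_ge0.
have dA := diam_ge0 A0; rewrite -poweR_EFin.
by apply: gt0_ler_poweR => //; rewrite in_itv/= leey andbT ?(le_trans dA Al).
Qed.

Lemma hausdorff_content_ge0 (R : realType) (s delta : R) (A : set R) :
  0 <= hausdorff_content s delta A.
Proof.
apply: le_ereal_inf_tmp => _ [U _ <-]; apply: nneseries_ge0 => i _ _.
exact: diam_pow_ge0.
Qed.

Lemma hausdorff_content_finite_cover (R : realType) (s delta l : R)
    (A : set R) (t : seq R) :
  (0 <= s)%R -> (0 <= delta)%R -> (l <= delta)%R ->
  (forall x, A x -> exists2 a, a \in t & x \in `[a, a + l]%R) ->
  hausdorff_content s delta A <= ((size t)%:R * l `^ s)%:E.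
Proof.
move=> s0 d0 ld cov.
pose U i : set R := if (i < size t)%N then [set` `[nth 0 t i, nth 0 t i + l]%R]
                    else set0.
have Usmall i : (i < size t)%N -> diam (U i) <= l%:E.
  by rewrite /U => ->; exact: diam_itv_le.
apply: ge_ereal_inf; exists (\sum_(0 <= i <oo) diam_pow s (U i)).
  exists U => //; split=> [x /cov[a ta xa]|i].
    by exists (index a t) => //; rewrite /U index_mem ta /= nth_index.
  case: (ltnP i (size t)) => it.
    by rewrite (le_trans (Usmall i it))// lee_fin.
  rewrite /U ltnNge it/=; apply: ge_ereal_sup => _ [[x y] [/= [] ]].
rewrite (@nneseries_split _ _ 0 (size t)); last first.
  by move=> i _; exact: diam_pow_ge0.
rewrite add0n eseries0 ?adde0; last first.
  by move=> i it _; rewrite /U ltnNge it/= /diam_pow eqxx.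
apply: (@le_trans _ _ (\sum_(0 <= i < size t) (l `^ s)%:E)).
  rewrite !big_mkord; apply: lee_sum => i _.
  by apply: diam_pow_le => //; exact: Usmall.
by rewrite sumEFin lee_fin big_const_nat subn0 iter_addr addr0 mulr_natl.
Qed.

(** There are at most 2^N intervals of length 2^-n, for N zeros before n, and
    [exists_sparse_scale] provides an n for which their s-sum is small. *)
Lemma hausdorff_measure_local_level_set (R : realType) (s : R) b :
  sparse_zeros R b -> (0 < s)%R -> hausdorff_measure s (local_level_set R b) = 0.
Proof.
move=> sp s0; apply/eqP; rewrite eq_le; apply/andP; split; last first.
  apply: le_trans (hausdorff_content_ge0 s 1 (local_level_set R b)) _.
  by apply: ereal_sup_ubound; exists 1%R => //=.
apply: ge_ereal_sup => _ [delta /= d0 <-].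
apply/lee_addgt0Pr => e e0; rewrite add0e.
have [n [nd ne]] := exists_sparse_scale sp s0 d0 e0.
have [t szt cov] := prefix_cover R n (coherent_flips 0 false b).
apply: le_trans (hausdorff_content_finite_cover (t := t) (ltW s0) (ltW d0) nd _) _.
  by rewrite local_level_setE => _ [b' /cov ? <-].
rewrite lee_fin; apply: le_trans ne; rewrite ler_wpM2r ?powR_ge0//.
by rewrite szt -natrX ler_nat prefix_count_coherent.
Qed.

Lemma hausdorff_dim_local_level_set (R : realType) b :
  sparse_zeros R b -> hausdorff_dim (local_level_set R b) = 0.
Proof.
move=> sp; apply/eqP; rewrite eq_le; apply/andP; split.
  apply/lee_addgt0Pr => e e0; rewrite add0e; apply: ereal_inf_lbound.
  exists e => //=; split; first exact: ltW.
  exact: hausdorff_measure_local_level_set.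
by apply: le_ereal_inf_tmp => _ [s [s0 _] <-]; rewrite lee_fin.
Qed.

Local Close Scope ereal_scope.

(** A countable union of null events: no zero from time m on, or at least
    n / (q + 1) zeros before every n from m on. *)
Lemma irregular_negligible (R : realType) : (@lebesgue_measure R).-negligible
  [set expansion_val R b | b in [set b | ~ (recurrent b /\ sparse_zeros R b)]].
Proof.
pose E m := [set expansion_val R b | b in avoids_zero_from m 0].
pose F (p : nat * nat) := [set expansion_val R b | b in [set b : expansion |
  forall n, (p.1 <= n)%N -> p.2.+1%:R^-1 * n%:R <= (zero_visits 0 b n)%:R :> R]].
have cover : [set expansion_val R b |
      b in [set b | ~ (recurrent b /\ sparse_zeros R b)]] `<=`
    \bigcup_m E m `|` \bigcup_m \bigcup_q F (m, q).
  move=> _ [b /= irr <-].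
  have [rec|nrec] := pselect (recurrent b).
    have /existsNP[eps /not_implyP[eps0 /existsNP[m nex]]] : ~ sparse_zeros R b.
      by move=> sp; apply: irr.
    have [q _ /(_ q (leqnn q)) /ltW /= qeps] :=
      near_infty_natSinv_lt (PosNum eps0).
    right; exists m => //; exists q => //; exists b => // n /= mn.
    rewrite leNgt; apply/negP => lt; apply: nex; exists n => //.
    by apply: (lt_le_trans lt); rewrite ler_wpM2r.
  move/existsNP: nrec => [m nex]; left; exists m => //; exists b => // n mn.
  by apply/eqP => n0; apply: nex; exists n.
apply: (@negligibleS _ _ _ (@lebesgue_measure R) _ _ cover).
apply: negligibleU.
  apply: negligible_bigcup => m; apply: prefix_null_negligible.
  exact: avoids_zero_from_null.
apply: negligible_bigcup => m; apply: negligible_bigcup => q.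
by apply: prefix_null_negligible; apply: many_visits_null; rewrite invr_gt0.
Qed.

Theorem theorem1p4 (R : realType) :
  {ae @lebesgue_measure R, forall x : R, x \in `[0, 1] ->
     forall b : expansion, expansion_val R b = x ->
       cantor_set (local_level_set R b) /\
       hausdorff_dim (local_level_set R b) = 0%E}.
Proof.
apply: negligibleS (irregular_negligible R) => x /= bad.
apply: contrapT => good; apply: bad => _ b bx.
have [rec sp] : recurrent b /\ sparse_zeros R b.
  by apply: contrapT => irr; apply: good; exists b.
split; last exact: hausdorff_dim_local_level_set.
split.
- exists (expansion_val R b); rewrite local_level_setE; exists b => // i _.
  by rewrite addbb; case: i => [|j]; rewrite ?addbb.
- exact: local_level_set_closed.
- exact: local_level_set_totally_disconnected.
- exact: local_level_set_perfect.
Qed.
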